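(* Let $I\subset\mathbf k[\mathbf x]$ be a monomial ideal with cofinite support and $x_i\notin I$ for all $i$. For every root $\alpha\in\mathcal R(I)$, the map $\iota_\alpha\colon N(\alpha)\to\operatorname{Aut}_{\mathbf k}(\mathbf k[\mathbf x]/I)$, $p\mapsto\exp(\overline\partial_{\alpha,p})$, is injective.
   Context: Setting: $\mathbf k$ is an algebraically closed field of characteristic zero, $n\ge1$, $M=\mathbb Z^n$ with canonical basis $E=\{e_1,\dots,e_n\}$, and $N_{\mathbf k}=\operatorname{Hom}(M,\mathbf k)\cong\mathbf k^n$ with dual basis $e_1^*,\dots,e_n^*$. $\mathbf k[\mathbf x]=\mathbf k[x_1,\dots,x_n]$ and $\mathbf x^m=x_1^{m_1}\cdots x_n^{m_n}$. For a monomial ideal $I$, $\operatorname{supp}(I)=\{m\in\mathbb Z^n_{\ge0}:\mathbf x^m\in I\}$; $I$ has cofinite support if $\mathbb Z^n_{\ge0}\setminus\operatorname{supp}(I)$ is finite. Set $A=\mathbf k[\mathbf x]/I$. For $\alpha\in\mathbb Z^n$ and $p\in N_{\mathbf k}$, $\partial_{\alpha,p}$ denotes the homogeneous derivation $\mathbf x^m\mapsto p(m)\mathbf x^{m+\alpha}$ of $\mathbf k[\mathbf x]$ (whenever it maps $\mathbf k[\mathbf x]$ to itself), and $\overline\partial_{\alpha,p}$ the derivation induced on $A$ when $\partial_{\alpha,p}(I)\subseteq I$. A degree $\alpha$ is inner if $\alpha\in\mathbb Z_{\ge0}^n$ and outer otherwise. For $\alpha\in\mathbb Z^n$ put $E_\alpha=\{e_i\in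 E : \alpha+e_i\in\mathbb Z^n_{\ge0}\setminus\operatorname{supp}(I)\}$. A root is a degree $\alpha\ne0$ for which there is a nonzero homogeneous derivation of $A$ of degree $\alpha$; $\mathcal R(I)$ is the set of roots. Explicitly, an inner $\alpha\neq 0$ is a root iff $E_\alpha\neq\varnothing$; an outer $\alpha$ is a root iff it has exactly one negative coordinate, say $\alpha_k=-1$, for every $\beta\in\operatorname{supp}(I)$ either $\alpha+\beta\in\operatorname{supp}(I)$ or $\alpha+\beta\notin\mathbb Z^n_{\ge0}$, and $E_\alpha\ne\varnothing$ (then $E_\alpha=\{e_k\}$). For an inner root, $N(\alpha)=\bigoplus_{e_i\in E_\alpha}\mathbf k e_i^*$; for an outer root with $\alpha_k=-1$, $N(\alpha)=\mathbf k e_k^*$. *)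

(* Defs.v *)
From HB Require Import structures.
From mathcomp Require Import all_boot all_order all_algebra.
From mathcomp Require Import ring_quotient generic_quotient.
From mathcomp.multinomials Require Import ssrcomplements mpoly.
From mathcomp Require Import ring zify.
From mathcomp Require boolp.

Set Implicit Arguments.
Unset Strict Implicit.
Unset Printing Implicit Defensive.

Import Order.TTheory GRing.Theory Num.Theory.
Local Open Scope ring_scope.
Local Open Scope quotient_scope.

Section QuotientAlgebra.
Variables (k : fieldType) (n : nat) (I : idealr {mpoly k[n]}).

Definition quot_scale (c : k) (a : {ideal_quot I}) : {ideal_quot I} :=
  \pi_{ideal_quot I} c%:MP * a.

Fact quot_scaleA c d a : quot_scale c (quot_scale d a) = quot_scale (c * d) a.
Proof. by rewrite /quot_scale mulrA -rmorphM /= -mpolyCM. Qed.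

Fact quot_scale1 : left_id 1 quot_scale.
Proof. by move=> a; rewrite /quot_scale mpolyC1 rmorph1 mul1r. Qed.

Fact quot_scaleDr : right_distributive quot_scale +%R.
Proof. by move=> c a b; rewrite /quot_scale mulrDr. Qed.

Fact quot_scaleDl a : {morph quot_scale^~ a : c d / c + d}.
Proof. by move=> c d; rewrite /quot_scale mpolyCD rmorphD mulrDl. Qed.

HB.instance Definition _ := GRing.Zmodule_isLmodule.Build k {ideal_quot I}
  quot_scaleA quot_scale1 quot_scaleDr quot_scaleDl.

Fact quot_scaleAl (c : k) (a b : {ideal_quot I}) : c *: (a * b) = (c *: a) * b.
Proof. exact: mulrA. Qed.

HB.instance Definition _ :=
  GRing.Lmodule_isLalgebra.Build k {ideal_quot I} quot_scaleAl.
HB.instance Definition _ :=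
  GRing.Lalgebra_isComAlgebra.Build k {ideal_quot I}.

Fact pi_scalable : scalable (\pi_{ideal_quot I} : {mpoly k[n]} -> {ideal_quot I}).
Proof. by move=> c f; rewrite -mul_mpolyC rmorphM. Qed.

End QuotientAlgebra.

Section Exponential.
Variables (k : fieldType) (B : comAlgType k).
Implicit Types (D f : B -> B) (a b : B).

Definition derivation D : Prop :=
  linear D /\ forall a b, D (a * b) = D a * b + a * D b.

Definition locally_nilpotent D : Prop := forall a, exists j, iter j D a == 0.

(* exp D a = \sum_j D^j a / j!, truncated at the least j with D^j a = 0. *)
Definition exp_der D (HD : locally_nilpotent D) a : B :=
  \sum_(j < ex_minn (HD a)) (j`!%:R : k)^-1 *: iter j D a.

Definition alg_automorphism f : Prop :=
  [/\ linear f, monoid_morphism f & bijective f].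

Definition algAut : Type := {f : B -> B | alg_automorphism f}.

Definition algAut_fun (f : algAut) : B -> B := sval f.
Coercion algAut_fun : algAut >-> Funclass.

Lemma algAut_ext (f g : algAut) : f =1 g -> f = g.
Proof.
case: f g => [f Hf] [g Hg] /= /boolp.funext /= efg; subst g.
by congr exist; apply: boolp.Prop_irrelevance.
Qed.

Lemma iterD_linear D j : linear D -> linear (iter j D).
Proof. by move=> HD c a b; elim: j => //= j ->; rewrite HD. Qed.

Lemma iterD0 D j : linear D -> iter j D 0 = 0.
Proof.
move=> HD; have D0 : D 0 = 0 by have := HD (-1) 0 0; rewrite scaler0 addr0 scaleN1r addNr.
by elim: j => //= j ->.
Qed.

Lemma iterD_ge D a i j : linear D -> (i <= j)%N -> iter i D a = 0 ->
  iter j D a = 0.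
Proof. by move=> HD /subnK <- H; rewrite iterD H iterD0. Qed.

Lemma exp_derE D (HD : locally_nilpotent D) N a : linear D ->
  iter N D a = 0 ->
  exp_der HD a = \sum_(j < N) (j`!%:R : k)^-1 *: iter j D a.
Proof.
move=> linD HN; rewrite /exp_der; case: ex_minnP => m /eqP Hm minm.
have le_mN : (m <= N)%N by apply: minm; apply/eqP.
rewrite -(big_mkord xpredT (fun j => (j`!%:R : k)^-1 *: iter j D a)).
rewrite -(big_mkord xpredT (fun j => (j`!%:R : k)^-1 *: iter j D a)).
rewrite [RHS](big_cat_nat (n := m)) //= [X in _ = _ + X]big_nat_cond [X in _ = _ + X]big1 ?addr0 //.
by move=> j /andP[/andP[le_mj _] _]; rewrite (iterD_ge linD le_mj Hm) scaler0.
Qed.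

Lemma triangle_sum (F : nat -> nat -> B) N :
  (forall i j, (N <= i + j)%N -> F i j = 0) ->
  \sum_(i < N) \sum_(j < N) F i j = \sum_(l < N) \sum_(i < l.+1) F i (l - i)%N.
Proof.
move=> F0.
have -> : \sum_(i < N) \sum_(j < N) F i j = \sum_(i < N) \sum_(j < N - i) F i j.
  apply: eq_bigr => i _.
  rewrite -(big_mkord xpredT (F i)) -(big_mkord xpredT (F i)).
  rewrite (big_cat_nat (n := N - i)%N) ?leq_subr //=.
  rewrite [X in _ + X]big_nat_cond [X in _ + X]big1 ?addr0 // => j.
  by rewrite leq_subLR => /andP[/andP[le_N _] _]; apply: F0.
elim: N {F0} => [|N IH]; first by rewrite !big_ord0.
rewrite big_ord_recr [RHS]big_ord_recr /= -IH subSnn big_ord1.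
rewrite [\sum_(i < N.+1) F i _]big_ord_recr /= subnn addrA -big_split /=.
congr (_ + _); apply: eq_bigr => i _.
by rewrite subSn ?(ltnW (ltn_ord i)) // big_ord_recr.
Qed.

Definition lin D (linD : linear D) : {linear B -> B} :=
  HB.pack_for {linear B -> B} D (GRing.isLinear.Build k B B *:%R D linD).

Lemma iter_leibniz D a b l : derivation D ->
  iter l D (a * b) = \sum_(i < l.+1) (iter i D a * iter (l - i) D b) *+ 'C(l, i).
Proof.
case=> linD DM.
set F := fun i j => iter i D a * iter j D b.
have DF i j : D (F i j) = F i.+1 j + F i j.+1 by rewrite /F DM.
rewrite -[iter l D _]/(iter l D (F 0 0)%N).
rewrite -[RHS]/(\sum_(i < l.+1) F i (l - i)%N *+ 'C(l, i)).
move: F DF => F DF; elim: l => [|l IH]; first by rewrite big_ord1.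
rewrite iterS IH -[LHS]/(lin linD _) raddf_sum.
under eq_bigr => i _ do
  rewrite raddfMn /= DF mulrnDl -subSn ?leq_ord //.
rewrite big_split [RHS]big_ord_recl /= !bin0 !subn0.
under [in RHS]eq_bigr => i _ do rewrite /bump leq0n add1n binS addnC mulrnDr subSS.
rewrite big_split /= addrCA; congr (_ + _).
rewrite big_ord_recl /= bin0 subn0; congr (_ + _).
rewrite [RHS]big_ord_recr /= bin_small // mulr0n addr0.
by apply: eq_bigr => i _; rewrite /bump add1n subSS.
Qed.

Hypothesis k_char0 : [pchar k] =i pred0.

Lemma fact_neq0 j : j`!%:R != 0 :> k.
Proof. by have /pcharf0P-> := k_char0; rewrite -lt0n fact_gt0. Qed.

Lemma common_nilpotent D (HD : locally_nilpotent D) a b : linear D ->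
  exists N, iter N D a = 0 /\ iter N D b = 0.
Proof.
move=> linD; have [[i /eqP Hi] [j /eqP Hj]] := (HD a, HD b).
exists (i + j)%N; split; first exact: iterD_ge (leq_addr _ _) Hi.
exact: iterD_ge (leq_addl _ _) Hj.
Qed.

Lemma exp_linear D (HD : locally_nilpotent D) : linear D -> linear (exp_der HD).
Proof.
move=> linD c a b; have [N [Ha Hb]] := common_nilpotent HD a b linD.
have Hab : iter N D (c *: a + b) = 0 by rewrite iterD_linear // Ha Hb scaler0 addr0.
rewrite (exp_derE HD linD Ha) (exp_derE HD linD Hb) (exp_derE HD linD Hab) scaler_sumr -big_split /=.
apply: eq_bigr => j _.
by rewrite iterD_linear // scalerDr !scalerA [c * _]mulrC.
Qed.

Lemma der1 D : derivation D -> D 1 = 0.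
Proof.
case=> _ DM; have /eqP := DM 1 1.
by rewrite !mulr1 mul1r -subr_eq0 opprD addrA subrr add0r oppr_eq0 => /eqP.
Qed.

Lemma exp_monoid_morphism D (HD : locally_nilpotent D) :
  derivation D -> monoid_morphism (exp_der HD).
Proof.
move=> derD; have [linD _] := derD; split.
  have D1 : iter 1 D 1 = 0 by exact: der1.
  by rewrite (exp_derE HD linD D1) big_ord1 fact0 invr1 scale1r.
move=> a b; have [N [Ha Hb]] := common_nilpotent HD a b linD.
have F0 i j : (N + N <= i + j)%N -> iter i D a * iter j D b = 0.
  move=> le_N; case: (leqP N i) => [le_Ni | lt_iN].
    by rewrite (iterD_ge linD le_Ni Ha) mul0r.
  have le_Nj : (N <= j)%N.
    by rewrite -(leq_add2l N) (leq_trans le_N) // leq_add2r ltnW.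
  by rewrite (iterD_ge linD le_Nj Hb) mulr0.
have le_NN : (N <= N + N)%N by exact: leq_addr.
have Hab : iter (N + N) D (a * b) = 0.
  rewrite (iter_leibniz _ _ _ derD) big1 // => i _.
  by rewrite F0 ?mul0rn // subnKC // -ltnS.
rewrite (exp_derE HD linD Hab).
rewrite (exp_derE HD linD (iterD_ge linD le_NN Ha)).
rewrite (exp_derE HD linD (iterD_ge linD le_NN Hb)).
rewrite mulr_suml; under [RHS]eq_bigr => i _ do rewrite mulr_sumr.
rewrite (triangle_sum (F := fun i j =>
  ((i`!%:R : k)^-1 *: iter i D a) * ((j`!%:R : k)^-1 *: iter j D b))); last first.
  by move=> i j /F0 H; rewrite -scalerAl -scalerAr H !scaler0.
apply: eq_bigr => l _; rewrite (iter_leibniz _ _ _ derD) scaler_sumr.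
apply: eq_bigr => i _; rewrite -scalerAl -scalerAr scalerA -scaler_nat scalerA.
congr (_ *: _).
have le_il : (i <= l)%N by rewrite -ltnS.
have := fact_neq0 l; rewrite -(bin_fact le_il) !natrM !mulf_eq0 !negb_or.
by move=> /and3P[nz1 nz2 nz3]; field; rewrite nz1 nz2 nz3.
Qed.

Lemma iter_opp D j a : linear D ->
  iter j (fun x => - D x) a = (-1) ^+ j *: iter j D a.
Proof.
move=> linD; elim: j => [|j IH] /=; first by rewrite scale1r.
by rewrite IH -[D (_ *: _)]/(lin linD _) linearZ /= exprS -scalerA scaleN1r.
Qed.

Lemma exp_opp_linear D : linear D -> linear (fun x => - D x).
Proof. by move=> linD c a b; rewrite linD opprD scalerN. Qed.

Lemma exp_opp_nilpotent D : linear D -> locally_nilpotent D ->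
  locally_nilpotent (fun x => - D x).
Proof.
by move=> linD HD a; have [j /eqP Hj] := HD a; exists j; rewrite iter_opp // Hj scaler0.
Qed.

Lemma exp_oppK D (HD : locally_nilpotent D)
    (HD' : locally_nilpotent (fun x => - D x)) : linear D ->
  cancel (exp_der HD) (exp_der HD').
Proof.
move=> linD a; have linD' := exp_opp_linear linD.
have [N /eqP Ha] := HD a.
have D_N i : iter i D (exp_der HD a) =
    \sum_(j < N) (j`!%:R : k)^-1 *: iter (i + j) D a.
  rewrite (exp_derE HD linD Ha) -[iter i D _]/(lin (iterD_linear i linD) _).
  by rewrite raddf_sum; apply: eq_bigr => j _; rewrite iterD; exact: (linearZ_LR (lin (iterD_linear i linD))).
have HN : iter N (fun x => - D x) (exp_der HD a) = 0.
  rewrite iter_opp // D_N big1 ?scaler0 // => j _.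
  by rewrite (iterD_ge linD (leq_addr j N) Ha) scaler0.
rewrite (exp_derE HD' linD' HN).
under eq_bigr => i _ do rewrite iter_opp // D_N !scaler_sumr.
rewrite (triangle_sum (F := fun i j => (i`!%:R : k)^-1 *:
  ((-1) ^+ i *: ((j`!%:R : k)^-1 *: iter (i + j) D a)))); last first.
  by move=> i j le_N; rewrite (iterD_ge linD le_N Ha) !scaler0.
have sum_l (l : nat) : \sum_(i < l.+1) (i`!%:R : k)^-1 *:
    ((-1) ^+ i *: (((l - i)`!%:R : k)^-1 *: iter (i + (l - i)) D a)) =
    (l == 0)%N%:R *: a.
  transitivity ((l`!%:R : k)^-1 *: ((1 - 1) ^+ l *: iter l D a)); last first.
    by rewrite subrr expr0n; case: l => [|l]; rewrite ?scale0r ?scaler0 // invr1 !scale1r.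
  rewrite exprBn scaler_suml scaler_sumr; apply: eq_bigr => i _.
  have le_il : (i <= l)%N by rewrite -ltnS.
  rewrite subnKC // !expr1n !mulr1 -mulr_natr !scalerA; congr (_ *: _).
  have := fact_neq0 l; rewrite -(bin_fact le_il) !natrM !mulf_eq0 !negb_or.
  move=> /and3P[nz1 nz2 nz3]; rewrite !invfM; field.
  by rewrite nz1 nz2 nz3 oner_neq0.
under eq_bigr => l _ do rewrite sum_l.
case: N Ha {D_N HN} => [/= -> | N _]; first by rewrite big_ord0.
by rewrite big_ord_recl /= scale1r big1 ?addr0 // => i _; rewrite scale0r.
Qed.

Lemma exp_automorphism D (HD : locally_nilpotent D) :
  derivation D -> alg_automorphism (exp_der HD).
Proof.
move=> derD; have [linD _] := derD; have linD' := exp_opp_linear linD.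
have HD' := exp_opp_nilpotent linD HD.
split; [exact: exp_linear | exact: exp_monoid_morphism | exists (exp_der HD')].
  exact: exp_oppK.
move=> a; have HD'' := exp_opp_nilpotent linD' HD'.
rewrite -[RHS](exp_oppK HD' HD'' linD').
have [N [H0 H1]] := common_nilpotent HD (exp_der HD' a) a linD.
have H2 : iter N (fun x => - - D x) (exp_der HD' a) = 0.
  by rewrite (iter_opp _ _ linD') iter_opp // H0 !scaler0.
rewrite (exp_derE HD linD H0) (exp_derE HD'' (exp_opp_linear linD') H2).
apply: eq_bigr => j _; congr (_ *: _).
by rewrite (iter_opp _ _ linD') iter_opp // scalerA -exprMn mulrNN mulr1 expr1n scale1r.
Qed.

End Exponential.

Section Roots.
Variables (k : fieldType) (n : nat).
Implicit Types (v w alpha : 'rV[int]_n) (p : 'rV[k]_n) (m : 'X_{1..n}).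
Implicit Types (f g : {mpoly k[n]}) (I : idealr {mpoly k[n]}).

(* An [idealr] is a proper ideal with boolean membership.
   M = Z^n is 'rV[int]_n and N_k = Hom(M, k) is 'rV[k]_n: the row p stands for
   the homomorphism [pairing p], and [delta_mx 0 i] is e_i, resp. e_i^*. *)
Definition pairing p v : k := \sum_i p 0 i * (v 0 i)%:~R.

Definition nonneg v : bool := [forall i, 0 <= v 0 i].

Definition mnm_of v : 'X_{1..n} := [multinom `|(v 0 i)%R|%N | i < n].

Definition of_mnm m : 'rV[int]_n := \row_i (m i)%:Z.

(* x^v, with the value 0 for the Laurent monomials lying outside of k[x]. *)
Definition xpow v : {mpoly k[n]} := if nonneg v then 'X_[mnm_of v] else 0.

Definition supp I : {pred 'rV[int]_n} :=
  [pred v | nonneg v && (xpow v \in I)].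

Definition cofinite_support I : Prop :=
  exists s : seq 'rV[int]_n,
    forall v, nonneg v -> v \notin supp I -> v \in s.

Definition monomial_ideal I : Prop :=
  exists S : 'X_{1..n} -> Prop, forall f,
    f \in I <-> exists s : seq ({mpoly k[n]} * 'X_{1..n}),
      (forall t, t \in s -> S t.2) /\ f = \sum_(t <- s) t.1 * 'X_[t.2].

(* x^m |-> p(m) x^(m + alpha), extended linearly. It is a derivation of k[x]
   when p(m) = 0 for each m in Z^n_{>=0} such that m + alpha is not. *)
Definition hder alpha p f : {mpoly k[n]} :=
  \sum_(m <- msupp f)
    (f@_m * pairing p (of_mnm m)) *: xpow (of_mnm m + alpha).

(* The map induced by hder alpha p on k[x]/I; the choice of the representative
   is immaterial when hder alpha p maps I to itself, see [hder_quotE]. *)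
Definition hder_quot I alpha p (a : {ideal_quot I}) : {ideal_quot I} :=
  \pi_{ideal_quot I} (hder alpha p (repr a)).

(* Degrees range over Z^n: the piece is 0 for v outside of Z^n_{>=0} \ supp I. *)
Definition graded_piece I v (a : {ideal_quot I}) : Prop :=
  exists c : k, a = c *: \pi_{ideal_quot I} (xpow v).

Definition homogeneous_of_degree I alpha
    (D : {ideal_quot I} -> {ideal_quot I}) : Prop :=
  forall v a, graded_piece v a -> graded_piece (v + alpha) (D a).

Definition is_root I alpha : Prop :=
  alpha <> 0 /\ exists D : {ideal_quot I} -> {ideal_quot I},
    [/\ derivation D, homogeneous_of_degree alpha D & exists a, D a <> 0].

(* i stands for the basis vector e_i. *)
Definition Eset I alpha : {set 'I_n} :=
  [set i | nonneg (alpha + delta_mx 0 i)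
           && (alpha + delta_mx 0 i \notin supp I)].

Definition dualbasis i : 'rV[k]_n := delta_mx 0 i.

Definition Nspace I alpha : {vspace 'rV[k]_n} :=
  if nonneg alpha
  then (\sum_(i in Eset I alpha) <[dualbasis i]>)%VS
  else (\sum_(i | (alpha 0 i == -1)%R) <[dualbasis i]>)%VS.

Lemma nonnegP v : reflect (forall i, 0 <= v 0 i) (nonneg v).
Proof. exact: forallP. Qed.

Lemma nonnegD v w : nonneg v -> nonneg w -> nonneg (v + w).
Proof.
by move=> /nonnegP Hv /nonnegP Hw; apply/nonnegP => i; rewrite mxE addr_ge0.
Qed.

Lemma nonneg_of_mnm m : nonneg (of_mnm m).
Proof. by apply/nonnegP => i; rewrite mxE. Qed.

Lemma mnm_ofK v : nonneg v -> of_mnm (mnm_of v) = v.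
Proof.
by move=> /nonnegP v_ge0; apply/rowP => i; rewrite mxE mnmE gez0_abs.
Qed.

Lemma of_mnmK m : mnm_of (of_mnm m) = m.
Proof. by apply/mnmP => i; rewrite mnmE mxE. Qed.

Lemma of_mnmD m m' : of_mnm (m + m') = of_mnm m + of_mnm m'.
Proof. by apply/rowP => i; rewrite !mxE mnmDE. Qed.

Lemma of_mnm1 i : of_mnm U_(i) = delta_mx 0 i.
Proof. by apply/rowP => j; rewrite !mxE mnm1E eqxx /= eq_sym; case: eqP. Qed.

Lemma xpow_mnm m : xpow (of_mnm m) = 'X_[m].
Proof. by rewrite /xpow nonneg_of_mnm of_mnmK. Qed.

Lemma xpow_out v : ~~ nonneg v -> xpow v = 0.
Proof. by rewrite /xpow => /negbTE->. Qed.

Lemma xpowM m v : nonneg v -> 'X_[m] * xpow v = xpow (of_mnm m + v).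
Proof.
move=> v_ge0; rewrite -{1 2}(mnm_ofK v_ge0) xpow_mnm -mpolyXD -of_mnmD.
by rewrite xpow_mnm.
Qed.

Lemma pairingD p v w : pairing p (v + w) = pairing p v + pairing p w.
Proof.
by rewrite /pairing -big_split; apply: eq_bigr => i _; rewrite mxE intrD mulrDr.
Qed.

Lemma pairing_delta p i : pairing p (delta_mx 0 i) = p 0 i.
Proof.
rewrite /pairing (bigD1 i) //= mxE !eqxx mulr1 big1 ?addr0 // => j ne_ji.
by rewrite mxE eqxx (negbTE ne_ji) mulr0.
Qed.

Lemma hderwE d alpha p f : (msize f <= d)%N -> hder alpha p f =
  \sum_(m : 'X_{1..n < d})
    (f@_m * pairing p (of_mnm m)) *: xpow (of_mnm m + alpha).
Proof.
pose J : subFinType _ := 'X_{1..n < d}.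
move=> le_fd; rewrite /hder (big_mksub J) /=; first last.
  by move=> x /msize_mdeg_lt/leq_trans/(_ le_fd).
  by rewrite msupp_uniq.
rewrite big_rmcond //= => j /memN_msupp_eq0 ->.
by rewrite mul0r scale0r.
Qed.

Lemma hder_linear alpha p : linear (hder alpha p).
Proof.
move=> c f g; set d := maxn (maxn (msize f) (msize g)) (msize (c *: f + g)).
have le_f : (msize f <= d)%N by rewrite !leq_max leqnn.
have le_g : (msize g <= d)%N by rewrite !leq_max leqnn orbT.
have le_h : (msize (c *: f + g) <= d)%N by rewrite leq_max leqnn orbT.
rewrite (hderwE _ _ le_f) (hderwE _ _ le_g) (hderwE _ _ le_h).
rewrite scaler_sumr -big_split; apply: eq_bigr => m _ /=.
by rewrite mcoeffD mcoeffZ scalerA mulrDl scalerDl mulrA.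
Qed.

Lemma hderX alpha p m :
  hder alpha p 'X_[m] = pairing p (of_mnm m) *: xpow (of_mnm m + alpha).
Proof. by rewrite /hder msuppX big_seq1 mcoeffX eqxx mul1r. Qed.

Lemma mpoly_linind (V : lmodType k) (E E' : {mpoly k[n]} -> V) :
  linear E -> linear E' -> (forall m, E 'X_[m] = E' 'X_[m]) -> E =1 E'.
Proof.
have lin0 (F : {mpoly k[n]} -> V) : linear F -> F 0 = 0.
  by move=> linF; have := linF (-1) 0 0; rewrite scaler0 addr0 scaleN1r addNr.
move=> linE linE' eqE f; elim/mpolyind: f => [|c m f _ _ IH].
  by rewrite !lin0.
by rewrite linE linE' eqE IH.
Qed.

Definition preserves alpha p :=
  forall v, nonneg v -> ~~ nonneg (v + alpha) -> pairing p v = 0.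

Lemma hderM alpha p f g : preserves alpha p ->
  hder alpha p (f * g) = hder alpha p f * g + f * hder alpha p g.
Proof.
move=> pres; have lin_h := hder_linear alpha p.
have hXM m m' : pairing p (of_mnm m') *: xpow (of_mnm m' + alpha) * 'X_[m] =
    pairing p (of_mnm m') *: xpow (of_mnm m + of_mnm m' + alpha).
  have [w_ge0 | w_out] := boolP (nonneg (of_mnm m' + alpha)).
    by rewrite -scalerAl mulrC xpowM // addrA.
  by rewrite pres ?nonneg_of_mnm // !scale0r mul0r.
move: f; apply: mpoly_linind => [c f1 f2|c f1 f2|m].
- by rewrite mulrDl -scalerAl lin_h.
- by rewrite lin_h !mulrDl scalerDr -!scalerAl addrACA.
move: g; apply: mpoly_linind => [c f1 f2|c f1 f2|m'].
- by rewrite mulrDr -scalerAr lin_h.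
- by rewrite lin_h !mulrDr scalerDr -!scalerAr addrACA.
rewrite -mpolyXD !hderX ['X_[m] * _]mulrC !hXM of_mnmD pairingD scalerDl.
by rewrite [of_mnm m' + of_mnm m]addrC.
Qed.

Lemma pi_eq0 I f : (\pi_{ideal_quot I} f == 0) = (f \in I).
Proof. by rewrite -[f in RHS]subr0 Quotient.idealrBE raddf0. Qed.

Lemma pi_linear I : linear (\pi_{ideal_quot I} : {mpoly k[n]} -> {ideal_quot I}).
Proof. by move=> c f g; rewrite raddfD /= pi_scalable. Qed.

Lemma pi_surj I (a : {ideal_quot I}) : exists f, a = \pi_{ideal_quot I} f.
Proof. by exists (repr a); rewrite reprK. Qed.

Lemma hder_stable I alpha p : monomial_ideal I -> preserves alpha p ->
  (forall m, 'X_[m] \in I -> hder alpha p 'X_[m] \in I) ->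
  forall f, f \in I -> hder alpha p f \in I.
Proof.
move=> [S HS] pres stabX f /HS [s [sS ->]].
have lin_h := hder_linear alpha p.
have h0 : hder alpha p 0 = 0 by rewrite /hder msupp0 big_nil.
have XI m : S m -> 'X_[m] \in I.
  move=> Sm; apply/HS; exists [:: (1, m)]; split; first by move=> t; rewrite inE => /eqP->.
  by rewrite big_seq1 mul1r.
elim: s sS => [|t s IH] sS; first by rewrite big_nil h0 rpred0.
rewrite big_cons -[t.1 * _]scale1r lin_h scale1r hderM // rpredD //; last first.
  by apply: IH => u us; apply: sS; rewrite inE us orbT.
have tI : 'X_[t.2] \in I by apply/XI/sS; rewrite inE eqxx.
by rewrite rpredD // idealMr // stabX.
Qed.

Section Induced.
Variables (I : idealr {mpoly k[n]}) (alpha : 'rV[int]_n) (p : 'rV[k]_n).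
Hypothesis pres : preserves alpha p.
Hypothesis stab : forall f, f \in I -> hder alpha p f \in I.
Local Notation D := (@hder_quot I alpha p).

Lemma hder_quotE f : D (\pi_{ideal_quot I} f) = \pi_{ideal_quot I} (hder alpha p f).
Proof.
rewrite /hder_quot; apply/eqP; rewrite -subr_eq0 -raddfB pi_eq0.
rewrite addrC -scaleN1r -hder_linear stab // scaleN1r addrC.
by rewrite -pi_eq0 raddfB /= reprK subrr.
Qed.

Lemma hder_quot_derivation : derivation D.
Proof.
split=> [c a b|a b]; have [f ->] := pi_surj a; have [g ->] := pi_surj b.
  by rewrite -pi_linear !hder_quotE hder_linear pi_linear.
by rewrite -rmorphM !hder_quotE hderM // rmorphD !rmorphM.
Qed.

Lemma hder_quot_homogeneous : homogeneous_of_degree alpha D.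
Proof.
have linD := hder_quot_derivation.1.
move=> v _ [c ->]; have [v_ge0|v_out] := boolP (nonneg v); last first.
  exists 0; rewrite scale0r xpow_out // -pi_scalable scaler0 hder_quotE.
  by rewrite /hder msupp0 big_nil raddf0.
exists (c * pairing p v); rewrite -pi_scalable hder_quotE.
rewrite -[c *: _]addr0 hder_linear raddfD /= [hder _ _ 0]/hder msupp0 big_nil raddf0 addr0.
by rewrite -{1}(mnm_ofK v_ge0) xpow_mnm hderX mnm_ofK // scalerA pi_scalable.
Qed.

Lemma hder_quot_nilpotent :
  (forall m, exists j, xpow (of_mnm m + alpha *+ j) \in I) ->
  locally_nilpotent D.
Proof.
move=> Hnil a; have [f ->] := pi_surj a; have linD := hder_quot_derivation.1.
elim/mpolyind: f => [|c m f _ _ [j /eqP Hj]].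
  by exists 0%N; rewrite /= raddf0.
have [i Hi] := Hnil m.
have piece l : graded_piece (of_mnm m + alpha *+ l)
    (iter l D (\pi_{ideal_quot I} 'X_[m])).
  elim: l => [|l IH]; first by exists 1; rewrite mulr0n addr0 xpow_mnm scale1r.
  by rewrite mulrSr addrA; apply: hder_quot_homogeneous.
have Xi : iter i D (\pi_{ideal_quot I} 'X_[m]) = 0.
  by have [d ->] := piece i; move: Hi; rewrite -pi_eq0 => /eqP->; rewrite scaler0.
exists (i + j)%N; rewrite pi_linear iterD_linear //.
rewrite (iterD_ge linD (leq_addr j i) Xi) (iterD_ge linD (leq_addl i j) Hj).
by rewrite scaler0 addr0.
Qed.

End Induced.

Lemma mem_sum_dual (P : pred 'I_n) p i :
  p \in (\sum_(j | P j) <[dualbasis j]>)%VS -> ~~ P i -> p 0 i = 0.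
Proof.
move=> /memv_sumP [u Hu ->] nPi; rewrite summxE big1 // => j Pj.
have /vlineP [c ->] := Hu j Pj; rewrite !mxE eqxx /=.
by have [eij|] := eqVneq i j; [rewrite eij Pj in nPi | rewrite mulr0].
Qed.

Section PiDerivations.
Variable I : idealr {mpoly k[n]}.
Local Notation pi := (\pi_{ideal_quot I}).

Definition pi_derivation (E : {mpoly k[n]} -> {ideal_quot I}) : Prop :=
  linear E /\ forall f g, E (f * g) = E f * pi g + pi f * E g.

Lemma pi_derivation_eq (E E' : {mpoly k[n]} -> {ideal_quot I}) :
  pi_derivation E -> pi_derivation E' -> (forall i, E 'X_i = E' 'X_i) -> E =1 E'.
Proof.
move=> [linE ME] [linE' ME'] eqX; apply: mpoly_linind => // m.
have E1 (F : {mpoly k[n]} -> {ideal_quot I}) :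
    (forall f g, F (f * g) = F f * pi g + pi f * F g) -> F 1 = 0.
  move=> MF; have /eqP := MF 1 1.
  by rewrite !mulr1 rmorph1 mulr1 mul1r -subr_eq0 opprD addrA subrr add0r oppr_eq0 => /eqP.
rewrite mpolyXE_id; elim/big_ind: _ => [|f g Hf Hg|i _].
- by rewrite !E1.
- by rewrite ME ME' Hf Hg.
by elim: (m i) => [|j IH]; rewrite ?expr0 ?E1 // exprS ME ME' eqX IH.
Qed.

Lemma derivation_pi (D : {ideal_quot I} -> {ideal_quot I}) :
  derivation D -> pi_derivation (D \o pi).
Proof.
by move=> [linD MD]; split=> [c f g|f g] /=; rewrite ?pi_linear ?linD // rmorphM MD.
Qed.

End PiDerivations.

Lemma outer_rootP I alpha : is_root I alpha -> ~~ nonneg alpha ->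
  exists2 i : 'I_n, alpha 0 i = -1 /\ (forall j, j != i -> 0 <= alpha 0 j)
    & forall m, 'X_[m] \in I -> (m i)%:R != 0 :> k ->
        xpow (of_mnm m + alpha) \in I.
Proof.
move=> [_ [D [derD homD [a Da]]]] a_out.
have piD := derivation_pi derD.
have zeroD : pi_derivation (fun _ => 0 : {ideal_quot I}).
  by split=> [c f g|f g]; rewrite ?scaler0 ?mul0r ?mulr0 addr0.
have [i Di] : exists i, D (\pi_{ideal_quot I} 'X_i) != 0.
  case: (boolP [exists i, D (\pi_{ideal_quot I} 'X_i) != 0]) => [/existsP //|].
  move=> /existsPn D0; case: Da.
  have [f ->] := pi_surj a.
  by apply: (pi_derivation_eq piD zeroD) => i; apply/eqP; have := D0 i; rewrite negbK.
have piece j : graded_piece (delta_mx 0 j + alpha) (D (\pi_{ideal_quot I} 'X_j)).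
  by apply: homD; exists 1; rewrite scale1r -of_mnm1 xpow_mnm.
have [c Dic] := piece i.
have /nonnegP ei_ge0 : nonneg (delta_mx 0 i + alpha).
  by apply: contraNT Di => /xpow_out e0; rewrite Dic e0 -pi_scalable scaler0 raddf0.
have alpha_ge0 j : j != i -> 0 <= alpha 0 j.
  by move=> ne_ji; have := ei_ge0 j; rewrite !mxE eqxx (negbTE ne_ji) add0r.
have alpha_i : alpha 0 i = -1.
  move: a_out; rewrite negb_forall => /existsP [j]; rewrite -ltNge => aj_lt0.
  have eji : j = i by apply/eqP; apply: contraTT aj_lt0 => /alpha_ge0; rewrite leNgt.
  rewrite {}eji in aj_lt0; have := ei_ge0 i; rewrite !mxE !eqxx /=.
  by move: (alpha 0 i) aj_lt0 => z; lia.
exists i => // m mI mi_neq0.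
have c_neq0 : c != 0 by apply: contraNneq Di => c0; rewrite Dic c0 scale0r.
have pres : preserves alpha (c *: dualbasis i).
  move=> v /nonnegP v_ge0; rewrite negb_forall => /existsP [j]; rewrite -ltNge mxE => v_lt0.
  have eji : j = i.
    apply/eqP; apply: contraTT v_lt0 => /alpha_ge0 aj_ge0.
    by rewrite -leNgt addr_ge0.
  rewrite {}eji alpha_i in v_lt0; have vi0 : v 0 i = 0 by have := v_ge0 i; move: (v 0 i) v_lt0 => z; lia.
  rewrite /pairing big1 // => l _; rewrite !mxE eqxx /=.
  by have [->|_] := eqVneq l i; rewrite ?vi0 ?mulr0 ?mul0r.
have pih : pi_derivation (\pi_{ideal_quot I} \o hder alpha (c *: dualbasis i)).
  split=> [d f g|f g] /=; first by rewrite hder_linear pi_linear.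
  by rewrite hderM // rmorphD !rmorphM.
have eqD := pi_derivation_eq piD pih.
have /eqD/(_ 'X_[m]) /= : forall j, (D \o \pi_{ideal_quot I}) 'X_j =
    (\pi_{ideal_quot I} \o hder alpha (c *: dualbasis i)) 'X_j.
  move=> j /=; rewrite hderX of_mnm1 pairing_delta !mxE eqxx /=.
  have [->|ne_ji] := eqVneq j i; first by rewrite mulr1 pi_scalable Dic.
  rewrite mulr0 scale0r raddf0; have [d ->] := piece j.
  rewrite xpow_out -?pi_scalable ?scaler0 ?raddf0 //.
  apply/negP => /nonnegP /(_ i); rewrite !mxE alpha_i eqxx.
  by rewrite eq_sym (negbTE ne_ji).
move: mI; rewrite -pi_eq0 => /eqP->.
have -> : D 0 = 0 by have := iterD0 1 derD.1.
move=> /esym/eqP; rewrite pi_eq0 hderX => hI.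
have pm : pairing (c *: dualbasis i) (of_mnm m) = c * (m i)%:R.
  rewrite /pairing (bigD1 i) //= big1 ?addr0; last first.
    by move=> j ne_ji; rewrite !mxE eqxx (negbTE ne_ji) mulr0 mul0r.
  by rewrite !mxE !eqxx mulr1.
rewrite pm in hI.
have nz : c * (m i)%:R != 0 by rewrite mulf_neq0.
rewrite -[xpow _](scalerK nz) -mul_mpolyC idealMr //.
Qed.

Lemma root_preserves I alpha p :
  is_root I alpha -> p \in Nspace I alpha -> preserves alpha p.
Proof.
move=> root_a; rewrite /Nspace; case: ifPn => [a_ge0 _|a_out pN] v v_ge0.
  by rewrite nonnegD.
have [i [ai aj] _] := outer_rootP root_a a_out.
rewrite negb_forall => /existsP [j]; rewrite -ltNge mxE => vj.
have eji : j = i.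
  apply/eqP; apply: contraTT vj => /aj aj_ge0.
  by rewrite -leNgt addr_ge0 // (nonnegP _ v_ge0).
rewrite {}eji ai in vj.
have vi0 : v 0 i = 0 by have := nonnegP _ v_ge0 i; move: (v 0 i) vj => z; lia.
rewrite /pairing big1 // => l _; have [->|ne_li] := eqVneq l i.
  by rewrite vi0 mulr0.
rewrite (mem_sum_dual pN) ?mul0r //; apply/negP => /eqP al.
by have := aj l ne_li; rewrite al.
Qed.

Lemma root_stable I alpha p : monomial_ideal I ->
  is_root I alpha -> p \in Nspace I alpha ->
  forall f, f \in I -> hder alpha p f \in I.
Proof.
move=> monI root_a pN; apply: hder_stable => //; first exact: root_preserves pN.
move=> m mI; rewrite hderX -mul_mpolyC.
have [a_ge0|a_out] := boolP (nonneg alpha).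
  by rewrite idealMr // -[_ + alpha]addrC -[alpha](mnm_ofK a_ge0) -xpowM ?nonneg_of_mnm // xpow_mnm idealMr.
have [i [ai aj] stab] := outer_rootP root_a a_out.
have [mi0|mi_neq0] := eqVneq ((m i)%:R : k) 0; last by rewrite idealMr // stab.
rewrite [pairing _ _](_ : _ = 0) ?mpolyC0 ?mul0r ?rpred0 //.
rewrite /pairing big1 // => l _; rewrite mxE.
have [->|ne_li] := eqVneq l i; first by rewrite -[_%:~R]/((m i)%:R) mi0 mulr0.
move: pN; rewrite /Nspace (negbTE a_out) => pN.
rewrite (mem_sum_dual pN) ?mul0r //; apply/negP => /eqP al.
by have := aj l ne_li; rewrite al.
Qed.

Lemma root_nilpotent I alpha : cofinite_support I -> is_root I alpha ->
  forall m, exists j, xpow (of_mnm m + alpha *+ j) \in I.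
Proof.
move=> [s Hs] root_a m; have [a_ge0|a_out] := boolP (nonneg alpha); last first.
  have [i [ai _] _] := outer_rootP root_a a_out.
  exists (m i).+1; rewrite xpow_out ?rpred0 //; apply/negP => /nonnegP /(_ i).
  by rewrite !mxE mulmxnE ai; lia.
have [i ai_neq0] : exists i, alpha 0 i != 0.
  case: (boolP [exists i, alpha 0 i != 0]) => [/existsP //|/existsPn a0].
  case: root_a.1.
  by apply/rowP => i; rewrite mxE; apply/eqP; have := a0 i; rewrite negbK.
have ai_gt0 : 0 < alpha 0 i by rewrite lt_neqAle eq_sym ai_neq0 (nonnegP _ a_ge0).
pose N := (\sum_(w <- s) `|(w 0 i)%R|%N).+1.
have a_geN j : nonneg (of_mnm m + alpha *+ j).
  apply: nonnegD; first exact: nonneg_of_mnm.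
  by apply/nonnegP => l; rewrite mulmxnE mulrn_wge0 // (nonnegP _ a_ge0).
exists N; apply/negPn/negP => nI.
have /Hs : nonneg (of_mnm m + alpha *+ N) by [].
rewrite inE a_geN (negbTE nI) /= => /(_ isT) in_s.
have : (`|((of_mnm m + alpha *+ N) 0 i)%R| < N)%N.
  by rewrite ltnS (big_rem _ in_s) /= leq_addr.
rewrite !mxE mulmxnE; move: (alpha 0 i) ai_gt0 => z z_gt0; nia.
Qed.

End Roots.

(* p |-> exp of the derivation induced by [hder alpha p]; the hypotheses are
   those ensuring that it is a well-defined automorphism. *)
Definition iota_root (k : fieldType) (n : nat) (I : idealr {mpoly k[n]})
    (k_char0 : has_pchar0 k) (monI : monomial_ideal I)
    (cofI : cofinite_support I) (alpha : 'rV[int]_n) (root_a : is_root I alpha)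
    (p : subvs_of (Nspace I alpha)) : algAut {ideal_quot I} :=
  let pres := root_preserves root_a (subvsP p) in
  let stab := root_stable monI root_a (subvsP p) in
  let nilp := hder_quot_nilpotent pres stab (root_nilpotent cofI root_a) in
  exist _ (exp_der nilp)
    (exp_automorphism k_char0 nilp (hder_quot_derivation pres stab)).

(* Main.v *)
Require Import Defs.
From HB Require Import structures.
From mathcomp Require Import all_boot all_order all_algebra.
From mathcomp Require Import ring_quotient.
From mathcomp.multinomials Require Import mpoly.

Import GRing.Theory.
Local Open Scope ring_scope.

(** The quotient A of k[x] by a monomial ideal I keeps the Z^n-grading: the
monomials outside of I form a basis of A, so that the coefficient of such a
monomial is a well-defined linear form on A ([coord]). If D is homogeneous of
degree alpha <> 0 and a is homogeneous of degree v, the terms D^j a / j! of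
exp(D) a lie in the pairwise distinct degrees v + j alpha; the part of degree
v + alpha of exp(D) a is therefore D a ([coord_exp_der]). Taking a = x_i, the
automorphism exp(D_p) determines D_p x_i = p_i x^(alpha + e_i), hence it
determines p_i as soon as this monomial is nonzero in A, i.e. when e_i lies in
E_alpha. The remaining coordinates of p in N(alpha) vanish
([Nspace_outside_Eset]). For inner alpha this is the definition of N(alpha);
for outer alpha it rests on E_alpha being nonempty ([root_Eset]), as any e_i in
E_alpha must compensate the only negative coordinate of alpha. *)

Section Coordinates.
Set Implicit Arguments.
Unset Strict Implicit.
Variables (k : fieldType) (n : nat) (I : idealr {mpoly k[n]}).
Local Notation pi := (\pi_{ideal_quot I}%qT).

(** Every monomial occurring in an element of I is a multiple of one of the
monomials generating I. *)
Lemma monomial_ideal_mcoeff f m :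
  monomial_ideal I -> f \in I -> 'X_[m] \notin I -> f@_m = 0.
Proof.
move=> [S HS] /HS [s [sS ->]] mI; rewrite raddf_sum big_seq big1 //= => t ts.
have tI : 'X_[t.2] \in I.
  apply/HS; exists [:: (1, t.2)]; split; last by rewrite big_seq1 mul1r.
  by move=> u; rewrite inE => /eqP ->; exact: sS ts.
apply/eqP; apply: contraNT mI.
rewrite -mcoeff_msupp (perm_mem (msuppMX _ _)) => /mapP [m' _ ->].
by rewrite addmC mpolyXD idealMr.
Qed.

(** The coefficient of x^m, read on an arbitrary representative; it does not
depend on this choice when I is monomial and x^m is not in I, see
[coord_pi]. *)
Definition coord (m : 'X_{1..n}) (a : {ideal_quot I}) : k := (repr a)@_m.

Variable m : 'X_{1..n}.
Hypotheses (monI : monomial_ideal I) (mI : 'X_[m] \notin I).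

Lemma coord_pi f : coord m (pi f) = f@_m.
Proof.
apply/eqP; rewrite -subr_eq0 -mcoeffB; apply/eqP.
by apply: monomial_ideal_mcoeff; rewrite // -pi_eq0 raddfB /= reprK subrr.
Qed.

Lemma coord_linear : scalar (coord m).
Proof.
move=> c a b; have [f ->] := pi_surj a; have [g ->] := pi_surj b.
by rewrite -pi_linear !coord_pi mcoeffD mcoeffZ.
Qed.

Lemma coord_graded_piece v a :
  graded_piece v a -> v <> of_mnm m -> coord m a = 0.
Proof.
move=> [c ->] neq_vm; rewrite -pi_scalable coord_pi mcoeffZ /xpow.
case: ifP => [v_ge0 | _]; last by rewrite mcoeff0 mulr0.
rewrite mcoeffX; case: eqP => [eq_vm|]; last by rewrite mulr0.
by case: neq_vm; rewrite -eq_vm mnm_ofK.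
Qed.

Lemma homogeneous_iter alpha (D : {ideal_quot I} -> {ideal_quot I}) v a j :
  homogeneous_of_degree alpha D -> graded_piece v a ->
  graded_piece (v + alpha *+ j) (iter j D a).
Proof.
move=> homD va; elim: j => [|j IH]; first by rewrite mulr0n addr0.
by rewrite mulrSr addrA; apply: homD.
Qed.

Lemma mulrn_row_inj (alpha : 'rV[int]_n) i j :
  alpha <> 0 -> alpha *+ i = alpha *+ j -> i = j.
Proof.
move=> alpha_neq0 eq_ij; apply/eqP/negPn/negP => neq_ij.
apply: alpha_neq0; apply/rowP => l; rewrite mxE; apply/eqP.
have /eqP := congr1 (fun w : 'rV[int]_n => w 0 l) eq_ij.
rewrite !mulmxnE -[_ *+ i]mulr_natr -[_ *+ j]mulr_natr -subr_eq0 -mulrBr.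
by rewrite mulf_eq0 subr_eq0 !natz eqz_nat (negbTE neq_ij) orbF.
Qed.

(** Of the terms of the exponential series at a, only D a has degree
v + alpha, as alpha has infinite order in Z^n. *)
Lemma coord_exp_der alpha (D : {ideal_quot I} -> {ideal_quot I})
    (nilD : locally_nilpotent D) v a :
  linear D -> homogeneous_of_degree alpha D -> alpha <> 0 ->
  graded_piece v a -> of_mnm m = v + alpha ->
  coord m (exp_der nilD a) = coord m (D a).
Proof.
move=> linD homD alpha_neq0 va vm.
pose phi : {scalar {ideal_quot I}} := HB.pack_for {scalar {ideal_quot I}}
  (coord m) (GRing.isLinear.Build k {ideal_quot I} k *%R (coord m) coord_linear).
have [N /eqP DN] := nilD a.
(* Enlarging the truncation bound makes the term of index 1 always present. *)
have DN2 : iter N.+2 D a = 0 by apply: (iterD_ge linD _ DN); rewrite !leqW.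
rewrite (exp_derE nilD linD DN2) -[LHS]/(phi _) linear_sum /=.
rewrite (bigD1 (inord 1)) //= big1 ?addr0 => [|j neq_j1].
  by rewrite inordK // -[LHS]/(phi _) invr1 scale1r.
rewrite -[LHS]/(phi _) linearZ /=; have va_j := homogeneous_iter j homD va.
rewrite (coord_graded_piece va_j) ?mulr0 // vm => /addrI.
rewrite -[RHS]mulr1n => /(mulrn_row_inj alpha_neq0) j1.
by case/eqP: neq_j1; apply/val_inj; rewrite /= inordK.
Qed.

End Coordinates.

Section RootSupport.
Set Implicit Arguments.
Unset Strict Implicit.
Variables (k : fieldType) (n : nat) (I : idealr {mpoly k[n]}).
Variable alpha : 'rV[int]_n.
Hypothesis root_a : is_root I alpha.
Local Notation pi := (\pi_{ideal_quot I}%qT).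

(** A nonzero derivation D of A is nonzero on some x_i; if D has degree alpha,
then D x_i is a multiple of x^(alpha + e_i), which is thus nonzero in A. *)
Lemma root_Eset : exists i, i \in Eset I alpha.
Proof.
case: root_a => _ [D [derD homD [a Da]]].
have zero_der : pi_derivation (fun _ => 0 : {ideal_quot I}).
  by split=> [c f g|f g]; rewrite ?scaler0 ?mul0r ?mulr0 addr0.
have [/existsP [i Di]|/existsPn D0] := boolP [exists i, D (pi 'X_i) != 0].
  have [c Dic] : graded_piece (delta_mx 0 i + alpha) (D (pi 'X_i)).
    by apply: homD; exists 1; rewrite scale1r -of_mnm1 xpow_mnm.
  have xI : xpow k (delta_mx 0 i + alpha) \notin I.
    by apply: contraNN Di; rewrite -pi_eq0 Dic => /eqP ->; rewrite scaler0.
  have x_ge0 : nonneg (delta_mx 0 i + alpha).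
    by apply: contraNT xI => /xpow_out ->; rewrite rpred0.
  by exists i; rewrite !inE addrC x_ge0.
case: Da; have [f ->] := pi_surj a.
apply: (pi_derivation_eq (derivation_pi derD) zero_der) => i.
by apply/eqP; have := D0 i; rewrite negbK.
Qed.

Lemma Nspace_outside_Eset (p : 'rV[k]_n) i :
  p \in Nspace I alpha -> i \notin Eset I alpha -> p 0 i = 0.
Proof.
rewrite /Nspace; case: ifPn => _ pN iE; first exact: (mem_sum_dual pN iE).
apply: (mem_sum_dual pN); apply: contraNN iE => /eqP alpha_i.
have [j jE] := root_Eset; suff -> : i = j by [].
(* For i <> j the i-th coordinate of alpha + e_j would be alpha_i = -1. *)
apply/eqP; move: jE; rewrite inE => /andP [/nonnegP /(_ i)].
by rewrite !mxE alpha_i eqxx; case: (i == j).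
Qed.

End RootSupport.

Theorem lemma2p2 (k : closedFieldType) (k_char0 : has_pchar0 k)
    (n : nat) (n_gt0 : (0 < n)%N) (I : idealr {mpoly k[n]})
    (monI : monomial_ideal I) (cofI : cofinite_support I)
    (x_notin_I : forall i : 'I_n, 'X_i \notin I)
    (alpha : 'rV[int]_n) (root_a : is_root I alpha) :
  injective (iota_root k_char0 monI cofI root_a).
Proof.
move=> p q eq_pq; apply/val_inj/rowP => i /=.
have [iE|iE] := boolP (i \in Eset I alpha); last first.
  by rewrite !(Nspace_outside_Eset root_a) ?subvsP.
move: iE; rewrite !inE => /andP [x_ge0]; rewrite x_ge0 /xpow x_ge0 /=.
set m := mnm_of _ => mI.
have m_eq : of_mnm m = delta_mx 0 i + alpha by rewrite [RHS]addrC; apply: mnm_ofK.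
have coord_iota r :
    coord m (iota_root k_char0 monI cofI root_a r (\pi_{ideal_quot I}%qT 'X_i))
  = vsval r 0 i.
  have pres := root_preserves root_a (subvsP r).
  have stab := root_stable monI root_a (subvsP r).
  have Xi : graded_piece (delta_mx 0 i) (\pi_{ideal_quot I}%qT 'X_i).
    by exists 1; rewrite scale1r -of_mnm1 xpow_mnm.
  have linD := (hder_quot_derivation pres stab).1.
  have homD := hder_quot_homogeneous pres stab.
  transitivity (coord m (hder_quot alpha (vsval r) (\pi_{ideal_quot I}%qT 'X_i))).
    exact: (coord_exp_der monI mI _ linD homD root_a.1 Xi m_eq).
  rewrite (hder_quotE stab) (coord_pi monI mI) hderX of_mnm1 pairing_delta.
  by rewrite -m_eq xpow_mnm mcoeffZ mcoeffX eqxx mulr1.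
by rewrite -!coord_iota eq_pq.
Qed.
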